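(* Let $F$ be a connected graph with $v\ge 3$ vertices and $\ell$ edges that is not 4-edge-connected and satisfies $\mathrm{wsat}(v,F)=\ell-1$. Then, for every integer $n\ge v$, $$\mathrm{wsat}(n,F)=g^*_2(n-v)+\ell-1.$$
   Context: All graphs are finite and simple. Given a graph $F$, an $F$-bootstrap percolation process is a sequence of graphs $H_0\subset H_1\subset\cdots\subset H_m$ on the same vertex set such that, for each $i=1,\ldots,m$, $H_i$ is obtained from $H_{i-1}$ by adding one edge that belongs to a copy of $F$ (a not necessarily induced subgraph isomorphic to $F$) in $H_i$. A graph $H$ on $[n]=\{1,\ldots,n\}$ is weakly $F$-saturated if there is an $F$-bootstrap percolation process $H=H_0\subset\cdots\subset H_m=K_n$. The number $\mathrm{wsat}(n,F)$ is the minimum number of edges of a weakly $F$-saturated graph on $[n]$. A graph is $k$-edge-connected if it remains connected whenever at most $k-1$ edges are removed. For a graph $F$ with $v$ vertices and $i\in[v]$, let $e_i=\min_{S\subset V(F),\,|S|=i}|E(F)\setminus E(F\setminus S)|-1$, where $F\setminus S$ is the subgraph of $F$ induced on $V(F)\setminus S$. Define $g^*_2(0)=0$ and, for $i\ge1$, $g^*_2(i)=\min(e_{i_1}+\cdots+e_{i_s})$, the minimum being over all $s\in[i]$ and all integers $1\le i_1,\ldots,i_s\le v-2$ with $i_1+\cdots+i_s=i$. *)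

(* Defs.v *)
From mathcomp Require Import all_boot.

Set Implicit Arguments.
Unset Strict Implicit.
Unset Printing Implicit Defensive.

(* A simple graph on the vertex set T is represented by its set of edges, an  *)
(* edge being a two-element set of vertices. Its number of edges is #|G|.     *)
Definition is_graph (T : finType) (G : {set {set T}}) : bool :=
  [forall e in G, #|e| == 2].

Definition complete_graph (T : finType) : {set {set T}} :=
  [set e : {set T} | #|e| == 2].

Definition adjacent (T : finType) (G : {set {set T}}) : rel T :=
  fun x y => [set x; y] \in G.

Definition connected_graph (T : finType) (G : {set {set T}}) : bool :=
  [forall x, forall y, connect (adjacent G) x y].

Definition edge_connected (T : finType) (k : nat) (G : {set {set T}}) : bool :=
  [forall D : {set {set T}},
     (D \subset G) && (#|D| < k) ==> connected_graph (G :\: D)].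

Definition induced (T : finType) (G : {set {set T}}) (A : {set T})
  : {set {set T}} := [set e in G | e \subset A].

Definition copy (V T : finType) (F : {set {set V}}) (f : {ffun V -> T})
  : {set {set T}} := [set f @: e | e : {set V} in F].

Definition bootstrap_step (V T : finType) (F : {set {set V}})
  : rel {set {set T}} := fun G G' =>
  [exists e : {set T}, [&& e \notin G, G' == e |: G &
     [exists f : {ffun V -> T},
        [&& injectiveb f, copy F f \subset G' & e \in copy F f]]]].

(* [connect] is the reflexive transitive closure, i.e. the existence of a     *)
(* finite, possibly empty, sequence of steps from G to the complete graph.    *)
Definition weakly_saturated (V T : finType) (F : {set {set V}})
    (G : {set {set T}}) : bool :=
  is_graph G && connect (bootstrap_step F) G (complete_graph T).

(* The default value of the minimum is attained by the complete graph.        *)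
Definition wsat (V : finType) (n : nat) (F : {set {set V}}) : nat :=
  \big[minn/#|complete_graph 'I_n|]_(G : {set {set 'I_n}}
                                     | weakly_saturated F G) #|G|.

(* e_i, for 1 <= i <= #|V|. The default value #|F| bounds every term. The     *)
(* truncation of the predecessor is harmless for connected F with at least    *)
(* two vertices: every nonempty S then meets an edge, so the minimum is > 0.  *)
Definition edge_cost (V : finType) (F : {set {set V}}) (i : nat) : nat :=
  (\big[minn/#|F|]_(S : {set V} | #|S| == i) #|F :\: induced F (~: S)|).-1.

(* Elements of 'I_(#|V|.-1) are at most #|V| - 2. The default value is        *)
(* attained by i = 1 + ... + 1, which is admissible as soon as 3 <= #|V|.     *)
Definition g2star (V : finType) (F : {set {set V}}) (i : nat) : nat :=
  if i == 0 then 0 else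
  \big[minn/i * edge_cost F 1]_(1 <= s < i.+1)
    \big[minn/i * edge_cost F 1]_(t : s.-tuple 'I_(#|V|.-1)
        | all (fun j : 'I_(#|V|.-1) => 1 <= j) t
          && (\sum_(j <- t) (j : nat) == i))
      \sum_(j <- t) edge_cost F j.

(* Main.v *)
(* Upper bound: a minimum weakly saturated graph on #|V| vertices shows that  *)
(* every copy of F spans a clique at the end of the process. Because F has an *)
(* edge cut of size at most 3, two cliques of order at least #|V| sharing two *)
(* vertices merge: one cut edge is the new edge, and the two shared vertices  *)
(* take care of the others. So i <= #|V| - 2 new vertices can be absorbed by  *)
(* a clique at the price of edge_cost F i edges.                              *)
(*   Lower bound: keep a list of vertex sets U (clusters) containing all      *)
(* edges added so far, with the sum of g2star (#|U| - #|V|) + #|F| - 1 at     *)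
(* most the number of initial edges lying in a cluster. When a copy of F on W *)
(* creates an edge, merge W with all clusters U sharing at least two vertices *)
(* with it: at most #|F| - 1 - edge_cost F (#|V| - #|U :&: W|) edges of the   *)
(* copy lie in U, and this pays for the subadditive g2star.                   *)

Require Import Defs.
From mathcomp Require Import all_boot.
From mathcomp Require Import zify.

Set Implicit Arguments.
Unset Strict Implicit.
Unset Printing Implicit Defensive.

(** Both bounds replace processes by closed sets: by [weakly_saturatedP], a graph percolates exactly
    when every [bootstrap_closed] set containing it contains all edges. For the upper bound, the
    hypothesis on [wsat] makes the vertex set of every completed copy of [F] a clique
    ([copy_clique]), so [#|F| - 1] edges produce a first clique. To absorb [i] further vertices,
    place on them a set [S] attaining [edge_cost F i] and the rest of [F] inside the clique. Only
    edges meeting [S] are missing, and the last of them comes for free ([forces_extend]). The two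
    cliques share [#|V| - i >= 2] vertices, and [clique_union] merges them across an edge cut of
    size at most 3. Following an optimal decomposition of [n - #|V|] gives [wsat_upper]. For the
    lower bound, the same accounting is read backwards. A [clustering] charges each cluster the
    value claimed for a vertex set of its size. [clustering_merge] keeps this invariant when a copy
    of [F] is completed, and [clustering_top] inflates one cluster to the whole vertex set, where
    its charge is the desired bound. *)

(** * Minima with a default value, and extension of injections *)

Lemma bigminn_le (I : eqType) d (r : seq I) (P : pred I) F j :
  j \in r -> P j -> \big[minn/d]_(i <- r | P i) F i <= F j.
Proof.
elim: r => // a r IHr; rewrite inE big_cons => /predU1P[<- ->|jr Pj].
  exact: geq_minl.
case: ifP => _; last exact: IHr.
exact: leq_trans (geq_minr _ _) (IHr jr Pj).
Qed.

Lemma bigminn_le_idx (I : Type) d (r : seq I) (P : pred I) F :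
  \big[minn/d]_(i <- r | P i) F i <= d.
Proof. by elim/big_rec: _ => // i x _ lexd; rewrite geq_min lexd orbT. Qed.

Lemma bigminn_attained (I : eqType) d (r : seq I) (P : pred I) F :
  \big[minn/d]_(i <- r | P i) F i = d \/
  exists2 j, j \in r & P j /\ \big[minn/d]_(i <- r | P i) F i = F j.
Proof.
elim: r => [|a r IHr]; first by left; rewrite big_nil.
rewrite big_cons; case: ifP => Pa; last first.
  case: IHr => [->|[j jr Fj]]; [by left | right; exists j => //].
  by rewrite inE jr orbT.
case: (leqP (F a) (\big[minn/d]_(j <- r | P j) F j)) => _.
  by right; exists a; rewrite ?mem_head.
case: IHr => [->|[j jr Fj]]; [by left | right; exists j => //].
by rewrite inE jr orbT.
Qed.

(* Greedy: a vertex outside D has at least #|V| allowed values, of which      *)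
(* fewer than #|V| are already taken.                                         *)
Lemma extend_injection (V T : finType) (D : {set V}) (h : V -> T)
    (A : V -> {set T}) :
  {in D &, injective h} -> (forall z, z \notin D -> #|V| <= #|A z|) ->
  exists f : {ffun V -> T},
    [/\ injective f, {in D, f =1 h} & forall z, z \notin D -> f z \in A z].
Proof.
have [k] := ubnP #|~: D|; elim: k D h => // k IHk D h leDk injh szA.
have [D0|[z]] := set_0Vmem (~: D).
  have DT z : z \in D by have/setP/(_ z) := D0; rewrite !inE => /negbFE.
  exists (finfun h); split => [x y|x _|z]; rewrite ?ffunE ?DT //.
  exact: injh.
rewrite inE => zD; have [y yA yD] : exists2 y, y \in A z & y \notin h @: D.
  have lt_h : #|h @: D| < #|A z|.
    apply: leq_trans (szA z zD); apply: leq_ltn_trans (leq_imset_card _ _) _.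
    by rewrite -cardsT; apply: proper_card; apply/properP; split=> //; exists z.
  by apply/subsetPn; apply: contraL lt_h => /subset_leq_card; rewrite -leqNgt.
pose h' x := if x == z then y else h x.
have h'D : {in D, h' =1 h}.
  by move=> x xD; rewrite /h'; case: eqP => // xz; rewrite -xz xD in zD.
have h'z : h' z = y by rewrite /h' eqxx.
have [||x|f [injf fD fA]] := IHk (z |: D) h'.
- rewrite -ltnS; apply: leq_trans leDk; rewrite ltnS.
  apply: proper_card; rewrite properC; apply/properP.
  by split; [exact: subsetUr | exists z; rewrite ?setU11].
- move=> a b /setU1P[->|aD] /setU1P[->|bD]; rewrite ?h'z ?h'D //.
  + by move=> yb; rewrite yb imset_f in yD.
  + by move=> ya; rewrite -ya imset_f in yD.
  + exact: injh.
- by rewrite !inE negb_or => /andP[_]; apply: szA.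
exists f; split=> // [x xD|x xD]; first by rewrite fD ?h'D // setU1r.
have [->|neq_xz] := eqVneq x z; first by rewrite fD ?setU11 // h'z.
by apply: fA; rewrite !inE negb_or neq_xz.
Qed.

Lemma exists_subset (T : finType) (B : {set T}) i :
  i <= #|B| -> exists2 A : {set T}, A \subset B & #|A| = i.
Proof.
rewrite -bin_gt0 -cards_draws => /card_gt0P[A].
by rewrite inE => /andP[AB /eqP Ai]; exists A.
Qed.

(** * The functions e_i and g*_2 *)

Lemma edge_cost_le (V : finType) (F : {set {set V}}) (S : {set V}) :
  edge_cost F #|S| <= #|F :\: induced F (~: S)|.-1.
Proof.
rewrite /edge_cost -!subn1; apply: leq_sub2r.
by apply: (@bigminn_le _ _ _ _ _ S); rewrite ?mem_index_enum.
Qed.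

Lemma edge_cost_attained (V : finType) (F : {set {set V}}) i :
  i <= #|V| ->
  exists2 S : {set V}, #|S| = i & edge_cost F i = #|F :\: induced F (~: S)|.-1.
Proof.
rewrite -cardsT /edge_cost => /exists_subset[S _ Si].
have [m_max|[S' _ [/eqP S'i ->]]] := bigminn_attained #|F|
    (index_enum {set V}) (fun S => #|S| == i) (fun S => #|F :\: induced F (~: S)|);
  last by exists S'.
(* If the minimum is the default [#|F|], any set of the right size attains it, since no set meets
   more than [#|F|] edges. *)
exists S => //; congr _.-1; apply/eqP; rewrite eqn_leq; apply/andP; split.
  by apply: (@bigminn_le _ _ _ _ _ S); rewrite ?mem_index_enum ?Si.
by rewrite m_max subset_leq_card // subsetDl.
Qed.

(** A subset of an optimal [j]-set meets no more edges than the set itself. *)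
Lemma edge_cost_mono (V : finType) (F : {set {set V}}) i j :
  i <= j <= #|V| -> edge_cost F i <= edge_cost F j.
Proof.
case/andP=> le_ij le_jV; have [S Sj ->] := edge_cost_attained F le_jV.
have [|S' S'S <-] := @exists_subset _ S i; first by rewrite Sj.
apply: leq_trans (edge_cost_le _ _) _.
rewrite -!subn1; apply: leq_sub2r; apply: subset_leq_card.
apply: setDS; apply/subsetP => e; rewrite !inE => /andP[-> /=].
by move/subset_trans; apply; rewrite setCS.
Qed.

Lemma edge_cost_leF (V : finType) (F : {set {set V}}) i :
  edge_cost F i <= #|F|.-1.
Proof. by rewrite /edge_cost -!subn1; apply: leq_sub2r; apply: bigminn_le_idx. Qed.

(** Plain lists stand in for the tuples of ordinals in [g2star]. The bound on their length is
    automatic because the parts are positive ([size_parts]). *)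
Definition parts (V : finType) (t : seq nat) := all (fun j => 0 < j < #|V|.-1) t.

Lemma size_parts V t : parts V t -> size t <= sumn t.
Proof. by elim: t => //= j t IHt /andP[/andP[j0 _] /IHt]; lia. Qed.

Lemma g2star_le (V : finType) (F : {set {set V}}) t :
  parts V t -> g2star F (sumn t) <= \sum_(j <- t) edge_cost F j.
Proof.
move=> Vt; rewrite /g2star; case: eqP => // /eqP t0.
have t_ord : all (fun j => j < #|V|.-1) t.
  by apply: sub_all Vt => j /andP[].
pose u : seq 'I_(#|V|.-1) := pmap insub t.
have uE : map val u = t.
  rewrite pmap_filter; last exact: insubK.
  by apply/all_filterP; rewrite (eq_all (isSome_insub _)).
have su : size u == size t by rewrite -uE size_map.
apply: leq_trans (@bigminn_le _ _ _ _ _ (size t) _ _) _ => //.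
  rewrite mem_index_iota ltnS (size_parts Vt) andbT lt0n size_eq0.
  by apply: contra t0 => /eqP->.
apply: leq_trans (@bigminn_le _ _ _ _ _ (Tuple su) _ _) _.
- by rewrite mem_index_enum.
- rewrite /= -[in sumn t]uE sumnE big_map eqxx andbT.
  by move: Vt; rewrite -{1}uE /parts all_map; apply: sub_all => j /andP[].
- by rewrite -[X in _ <= bigop _ X _]uE big_map.
Qed.

Lemma g2star_attained (V : finType) (F : {set {set V}}) i :
  2 < #|V| ->
  exists t, [/\ parts V t, sumn t = i & g2star F i = \sum_(j <- t) edge_cost F j].
Proof.
move=> V3; rewrite /g2star; case: eqP => [->|_].
  by exists [::]; rewrite big_nil.
have ex_default : exists t,
    [/\ parts V t, sumn t = i & i * edge_cost F 1 = \sum_(j <- t) edge_cost F j].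
  exists (nseq i 1); split.
  - by rewrite /parts all_nseq; lia.
  - by rewrite sumn_nseq mul1n.
  - by rewrite big_nseq iter_addn_0 mulnC.
set d := i * _; set Fs := BIG_F.
have [-> //|[s _ [_ ->]]] := bigminn_attained d (index_iota 1 i.+1) predT Fs.
rewrite {}/Fs; set P := BIG_P; set Ft := BIG_F.
have [-> //|[t _ [/andP[t0 /eqP ti] ->]]] := bigminn_attained d (index_enum _) P Ft.
exists (map val t); split; rewrite ?big_map //; last by rewrite sumnE big_map.
by rewrite /parts all_map; apply: sub_all t0 => j /= ->; apply: ltn_ord.
Qed.

Section G2star.
Variables (V : finType) (F : {set {set V}}).
Hypothesis V3 : 2 < #|V|.

Lemma g2star_add a b : g2star F (a + b) <= g2star F a + g2star F b.
Proof.
have [t [Vt <- ->]] := g2star_attained F a V3.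
have [u [Vu <- ->]] := g2star_attained F b V3.
by rewrite -sumn_cat -big_cat g2star_le // /parts all_cat; apply/andP.
Qed.

(** It suffices to go down by one: in an optimal decomposition of [a.+1], drop the first part if it
    is 1, and otherwise lower it by one, which is no dearer by [edge_cost_mono]. *)
Lemma g2star_mono a b : a <= b -> g2star F a <= g2star F b.
Proof.
move/subnK <-; elim: (b - a) => // k /leq_trans; apply; rewrite addSn; move: (k + a) => {}a.
have [t []] := g2star_attained F a.+1 V3.
case: t => [|[|[|j]] t] // /andP[// Vj Vt] /= ta ->; rewrite big_cons.
  have <- : sumn t = a by lia.
  exact: leq_trans (g2star_le F Vt) (leq_addl _ _).
have -> : a = sumn (j.+1 :: t) by rewrite /=; lia.
apply: leq_trans (g2star_le F _) _; first by apply/andP; split=> //; lia.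
by rewrite big_cons leq_add2r edge_cost_mono //; lia.
Qed.

Lemma g2star_edge_cost j : j < #|V|.-1 -> 0 < j -> g2star F j <= edge_cost F j.
Proof.
move=> jV j0; have := @g2star_le V F [:: j].
by rewrite /= big_seq1 addn0 j0 jV; apply.
Qed.

End G2star.

(** * Closed graphs *)

Lemma copy_card (V T : finType) (F : {set {set V}}) (f : {ffun V -> T}) :
  injective f -> #|copy F f| = #|F|.
Proof. by move=> injf; rewrite card_imset //; apply: imset_inj. Qed.

Lemma card_copy_edge (V T : finType) (F : {set {set V}}) (f : {ffun V -> T}) :
  is_graph F -> injective f -> forall e, e \in copy F f -> #|e| = 2.
Proof.
move=> /forall_inP Fg injf _ /imsetP[e eF ->].
by rewrite card_imset //; apply/eqP/Fg.
Qed.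

(** [K] may contain sets that are not edges. This freedom is used for preimages and for the family
    of all subsets of clusters. *)
Definition bootstrap_closed (V T : finType) (F : {set {set V}})
    (K : {set {set T}}) :=
  forall (f : {ffun V -> T}) e,
    injective f -> e \in copy F f -> copy F f :\ e \subset K -> e \in K.

Lemma not_bootstrap_closed (V T : finType) (F : {set {set V}})
    (K : {set {set T}}) :
  bootstrap_closed F K \/
  exists (f : {ffun V -> T}) e,
    [/\ injective f, e \in copy F f, copy F f :\ e \subset K & e \notin K].
Proof.
have [/existsP[f /existsP[e /and4P[/injectiveP injf ef fK eK]]]|none] :=
  boolP [exists f : {ffun V -> T}, exists e : {set T},
    [&& injectiveb f, e \in copy F f, copy F f :\ e \subset K & e \notin K]].
  by right; exists f, e.
left=> f e /injectiveP injf ef fK; apply: contraR none => eK.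
by apply/existsP; exists f; apply/existsP; exists e; rewrite injf ef fK.
Qed.

Section Bootstrap.
Variables (V T : finType) (F : {set {set V}}).
Hypothesis F_graph : is_graph F.

Lemma reachable_closed (G H K : {set {set T}}) :
  connect (bootstrap_step F) G H -> bootstrap_closed F K -> G \subset K ->
  H \subset K.
Proof.
move=> /connectP[p Gp ->] Kclosed {H}.
elim: p G Gp => //= H p IHp G /andP[/existsP[e /and3P[eG /eqP HE]]].
case/existsP=> f /and3P[/injectiveP injf fH ef] Hp GK; apply: IHp Hp _.
rewrite HE subUset sub1set GK andbT; apply: (Kclosed f) => //.
apply: subset_trans GK; apply/subsetP => d /setD1P[d_e df].
by have := subsetP fH d df; rewrite HE !inE (negPf d_e).
Qed.

Lemma reachable_graph (G H : {set {set T}}) :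
  connect (bootstrap_step F) G H -> is_graph G -> is_graph H.
Proof.
move=> /connectP[p Gp ->] {H}; elim: p G Gp => //= H p IHp G /andP[GH Hp] Gg.
apply: IHp Hp _; move: GH => /existsP[e /and3P[eG /eqP-> /existsP[f]]].
case/and3P=> /injectiveP injf _ ef.
apply/forall_inP => d /setU1P[->|dG]; last exact: (forall_inP Gg).
by apply/eqP; apply: card_copy_edge ef.
Qed.

Lemma graph_sub_complete (G : {set {set T}}) :
  is_graph G = (G \subset complete_graph T).
Proof.
apply/forall_inP/subsetP => Gg e eG; first by rewrite inE Gg.
by have := Gg e eG; rewrite inE.
Qed.

(** A process never leaves a closed set containing its start. Conversely, a largest graph reachable
    from [G] is closed, for otherwise one more step would enlarge it. *)
Lemma weakly_saturatedP (G : {set {set T}}) :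
  weakly_saturated F G <->
  is_graph G /\ forall K, bootstrap_closed F K -> G \subset K ->
                          complete_graph T \subset K.
Proof.
split=> [/andP[Gg GT]|[Gg GT]].
  by split=> // K; apply: reachable_closed.
rewrite /weakly_saturated Gg /=.
have [/= H GH Hmax] := arg_maxnP (fun H : {set {set T}} => #|H|)
  (connect0 (bootstrap_step F) G).
have HT : H \subset complete_graph T.
  by rewrite -graph_sub_complete (reachable_graph GH).
have GsubH : G \subset H.
  move/connectP: GH => [p Gp ->] {H Hmax HT}.
  elim: p G Gp {Gg GT} => //= H p IHp G /andP[/existsP[e /and3P[_ /eqP-> _]] Hp].
  exact: subset_trans (subsetUr _ _) (IHp _ Hp).
have [/GT/(_ GsubH) TH|[f [e [injf ef fH eH]]]] := not_bootstrap_closed F H.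
  by have -> : complete_graph T = H by apply/eqP; rewrite eqEsubset TH HT.
have /Hmax : connect (bootstrap_step F) G (e |: H).
  apply: connect_trans GH (connect1 _); apply/existsP; exists e.
  rewrite eH eqxx /=; apply/existsP; exists f; rewrite ef andbT.
  rewrite -subDset setDE -setDE fH andbT; exact/injectiveP.
by rewrite /= cardsU1 eH add1n ltnn.
Qed.

Lemma complete_weakly_saturated : weakly_saturated F (complete_graph T).
Proof. by rewrite /weakly_saturated connect0 graph_sub_complete subxx. Qed.

End Bootstrap.

Lemma wsat_le (V : finType) (F : {set {set V}}) n (G : {set {set 'I_n}}) :
  weakly_saturated F G -> wsat n F <= #|G|.
Proof. by move=> Gws; apply: (@bigminn_le _ _ _ _ _ G); rewrite ?mem_index_enum. Qed.

Lemma wsat_attained (V : finType) (F : {set {set V}}) n :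
  exists2 G : {set {set 'I_n}}, weakly_saturated F G & wsat n F = #|G|.
Proof.
rewrite /wsat; have [->|[G _ [Gws ->]]] := bigminn_attained #|complete_graph 'I_n|
  (index_enum _) (@weakly_saturated V 'I_n F) (fun G => #|G|); last by exists G.
exists (complete_graph 'I_n) => //; exact: complete_weakly_saturated.
Qed.

(** * Cliques spanned by copies of F *)

Definition clique (T : finType) (K : {set {set T}}) (A : {set T}) :=
  {in A &, forall x y, x != y -> [set x; y] \in K}.

Lemma clique_edge (T : finType) (K : {set {set T}}) (A e : {set T}) :
  clique K A -> #|e| = 2 -> e \subset A -> e \in K.
Proof.
move=> KA /eqP/cards2P[x [y [xy ->]]]; rewrite subUset !sub1set => /andP[].
by move=> xA yA; apply: KA.
Qed.

Lemma graph_edgeP (V : finType) (F : {set {set V}}) e :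
  is_graph F -> e \in F -> exists x y, x != y /\ e = [set x; y].
Proof. by move=> /forall_inP Fg /Fg /cards2P[x [y [xy ->]]]; exists x, y. Qed.

Section SelfPercolating.
Variables (V : finType) (F : {set {set V}}).
Hypotheses (F_graph : is_graph F) (F_wsat : wsat #|V| F = #|F| - 1).
Hypothesis F_gt0 : 0 < #|F|.

(* A minimum weakly saturated graph on #|V| vertices has #|F| - 1 edges, so   *)
(* its first step completes a copy of F and uses all of its edges.            *)
Lemma copy_clique (T : finType) (K : {set {set T}}) (f : {ffun V -> T}) :
  bootstrap_closed F K -> injective f -> copy F f \subset K ->
  clique K (f @: V).
Proof.
move=> Kclosed injf fK; have [G /weakly_saturatedP[//|Gg GT] GE] := wsat_attained F #|V|.
have [g [injg Gg' ]] : exists g : {ffun V -> 'I_#|V|}, injective g /\ G \subset copy F g.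
  (* If [G] were closed it would be complete and have at least [#|F|] edges, one too many. Otherwise
     a copy minus [e] lies in [G] and equals it by cardinality. *)
  have [GG|[g [e [injg eg gG eG]]]] := not_bootstrap_closed F G.
    have /subset_leq_card := GT G GG (subxx _).
    have Fle : #|F| <= #|complete_graph 'I_#|V| |.
      pose r : {ffun V -> 'I_#|V|} := [ffun x => enum_rank x].
      have injr : injective r by move=> x y; rewrite !ffunE => /enum_rank_inj.
      rewrite -(copy_card F injr); apply/subset_leq_card/subsetP => e er.
      by rewrite inE (card_copy_edge F_graph injr er).
    by move: F_wsat; rewrite GE; lia.
  exists g; split=> //; have gD : #|copy F g :\ e| = #|G|.
    by have := cardsD1 e (copy F g); rewrite eg copy_card // -GE F_wsat; lia.
  have /eqP <- : copy F g :\ e == G by rewrite eqEcard gG gD leqnn.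
  exact: subsetDl.
have bijg : bijective g by apply: inj_card_bij => //; rewrite card_ord.
(* The map [h] carries the copy given by [g] to the one given by [f]. The preimage [K'] of [K] under
   [h] is closed and contains [G], hence contains every edge. *)
have [g' gK g'K] := bijg; pose h := [ffun x => f (g' x)].
have injh : injective h.
  by move=> x y; rewrite !ffunE => /injf /(can_inj g'K).
have hg (A : {set V}) : h @: (g @: A) = f @: A.
  by rewrite -imset_comp; apply: eq_imset => x /=; rewrite ffunE gK.
pose K' := [set d : {set 'I_#|V|} | h @: d \in K].
have K'closed : bootstrap_closed F K'.
  move=> k e injk ek kK'; rewrite inE.
  pose hk := [ffun x => h (k x)].
  have hkE (A : {set V}) : hk @: A = h @: (k @: A).
    by rewrite -imset_comp; apply: eq_imset => x /=; rewrite [LHS]ffunE.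
  apply: (Kclosed hk).
  - by move=> x y; rewrite [LHS]ffunE [RHS]ffunE => /injh/injk.
  - by case/imsetP: ek => d dF ->; rewrite -hkE imset_f.
  apply/subsetP => c /setD1P[ne /imsetP[d dF cE]]; move: ne; rewrite {c}cE hkE => ne.
  have: k @: d \in K' by apply: (subsetP kK'); rewrite !inE imset_f // andbT;
    apply: contraNneq ne => ->.
  by rewrite inE.
have GK' : G \subset K'.
  apply: subset_trans Gg' _; apply/subsetP => _ /imsetP[d dF ->].
  by rewrite inE hg; apply: (subsetP fK); apply: imset_f.
have /subsetP TK' := GT K' K'closed GK'.
move=> _ _ /imsetP[x _ ->] /imsetP[y _ ->] xy.
have := TK' [set g x; g y]; rewrite !inE cards2 (inj_eq injg).
rewrite (contraNneq _ xy) => [/(_ isT)|-> //].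
by rewrite imsetU1 imset_set1 !ffunE !gK.
Qed.

End SelfPercolating.

(** * Merging cliques along an edge cut *)

Lemma exists_injection (V T : finType) (C : {set V}) (I : {set T}) (t0 : T) :
  #|C| <= #|I| ->
  exists h : V -> T, {in C &, injective h} /\ {in C, forall z, h z \in I}.
Proof.
move=> leCI; exists (fun z => nth t0 (enum I) (index z (enum C))).
have ltI z : z \in C -> index z (enum C) < size (enum I).
  by move=> zC; rewrite -cardE (leq_trans _ leCI) // cardE index_mem mem_enum.
split=> [z w zC wC /eqP|z zC]; last by rewrite -mem_enum mem_nth ?ltI.
rewrite nth_uniq ?enum_uniq ?ltI // => /eqP eq_zw.
by rewrite -[z](@nth_index _ z _ (enum C)) ?eq_zw ?nth_index ?mem_enum.
Qed.

Lemma copy_missing_edge (V T : finType) (F : {set {set V}}) (f : {ffun V -> T})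
    (e : {set V}) (K : {set {set T}}) :
  (forall d, d \in F -> d != e -> f @: d \in K) -> copy F f :\ (f @: e) \subset K.
Proof.
move=> FK; apply/subsetP => c /setD1P[ne /imsetP[d dF cE]]; rewrite {c}cE in ne *.
by apply: FK => //; apply: contraNneq ne => ->.
Qed.

(** Take for [A1] a component left after deleting at most three edges. All edges across lie among
    the deleted ones. One of them is [ab], and each of the remaining two or fewer contributes to [C]
    an endpoint outside [ab]. *)
Lemma edge_cut_le3 (V : finType) (F : {set {set V}}) :
    is_graph F -> connected_graph F -> ~~ edge_connected 4 F ->
  exists (A1 C : {set V}) a b,
    [/\ #|C| <= 2, [set a; b] \in F, a \in A1 :\: C, b \in ~: A1 :\: C &
        forall x y, [set x; y] \in F -> x \in A1 -> y \notin A1 ->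
          [|| [set x; y] == [set a; b], x \in C | y \in C]].
Proof.
move=> Fg Fc; rewrite negb_forall => /existsP[D].
rewrite negb_imply -andbA => /and3P[DF D4].
rewrite negb_forall => /existsP[x0]; rewrite negb_forall => /existsP[y0 x0y0].
pose A1 := [set z | connect (adjacent (F :\: D)) x0 z].
have cutD x y : [set x; y] \in F -> x \in A1 -> y \notin A1 -> [set x; y] \in D.
  move=> xyF; rewrite !inE => x0x; apply: contraNT => xyD.
  by apply: connect_trans x0x (connect1 _); rewrite /adjacent !inE xyD.
have [a [b [abF aA bA]]] :
    exists a b, [/\ [set a; b] \in F, a \in A1 & b \notin A1].
  have /forallP/(_ x0)/forallP/(_ y0)/connectP[p Fp y0E] := Fc.
  have: x0 \in A1 by rewrite inE.
  have: last x0 p \notin A1 by rewrite -y0E inE.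
  elim: p (x0) Fp {y0E} => [|y p IHp] x /=; first by move=> _ /negPf->.
  case/andP=> xy yp lastA xA; have [yA|yA] := boolP (y \in A1).
    exact: IHp yp lastA yA.
  by exists x, y.
(* The default [a] is harmless: it is removed from [C] below, and an edge other than [ab] always has
   an endpoint outside [ab]. *)
pose c (d : {set V}) := odflt a [pick z in d :\: [set a; b]].
exists A1, ((c @: (D :\ [set a; b])) :\: [set a; b]), a, b; split=> //.
- apply: leq_trans (subset_leq_card (subsetDl _ _)) _.
  apply: leq_trans (leq_imset_card _ _) _.
  by move: D4; rewrite (cardsD1 [set a; b]) cutD.
- by rewrite in_setD aA andbT !inE eqxx.
- by rewrite in_setD in_setC bA andbT !inE eqxx orbT.
move=> x y xyF xA yA; have [//|ne /=] := eqVneq.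
have xyD : [set x; y] \in D :\ [set a; b] by rewrite !inE ne cutD.
have xneqy : x != y by apply: contraNneq yA => <-.
have cxy : c [set x; y] \in [set x; y] :\: [set a; b].
  rewrite /c; case: pickP => // none; case/negP: ne.
  rewrite eqEcard !cards2 xneqy -setD_eq0 ltnS leq_b1 andbT.
  by apply/eqP/setP => z; rewrite none inE.
have cC : c [set x; y] \in (c @: (D :\ [set a; b])) :\: [set a; b].
  by move: cxy; rewrite !in_setD imset_f // andbT => /andP[].
by case/setDP: cxy => /set2P[] <- _; rewrite cC ?orbT.
Qed.

Lemma clique_union (V T : finType) (F : {set {set V}}) (K : {set {set T}})
    (A B : {set T}) :
  is_graph F -> connected_graph F -> ~~ edge_connected 4 F ->
  bootstrap_closed F K -> clique K A -> clique K B ->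
  #|V| <= #|A| -> #|V| <= #|B| -> 1 < #|A :&: B| -> clique K (A :|: B).
Proof.
move=> Fg Fc F4 Kclosed KA KB leVA leVB AB2.
(* Across the cut, C absorbs all edges but ab: mapping C into A :&: B, ab to  *)
(* xy, and the two sides into A and B leaves xy as the only missing edge.     *)
have KAB x y : x \in A :\: B -> y \in B :\: A -> [set x; y] \in K.
  move=> /setDP[xA xB] /setDP[yB yA].
  have [A1 [C [a [b [C2 abF aA1 bA1 cut]]]]] := edge_cut_le3 Fg Fc F4.
  move: aA1 bA1; rewrite !inE => /andP[aC aA1] /andP[bC bA1].
  have neq_ab : a != b by apply: contraNneq bA1 => <-.
  have [h [injh hC]] : exists h : V -> T,
      {in C &, injective h} /\ {in C, forall z, h z \in A :&: B}.
    by apply: exists_injection => //; lia.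
  pose h' z := if z == a then x else if z == b then y else h z.
  have h'a : h' a = x by rewrite /h' eqxx.
  have h'b : h' b = y by rewrite /h' eqxx eq_sym (negPf neq_ab).
  have h'C : {in C, h' =1 h}.
    move=> z zC; rewrite /h'; case: eqP => [za|_]; first by rewrite -za zC in aC.
    by case: eqP => // zb; rewrite -zb zC in bC.
  have h'CAB z : z \in C -> h' z \in A /\ h' z \in B.
    by move=> zC; rewrite h'C //; apply/setIP/hC.
  (* The remaining vertices can be placed greedily, each side in its own clique, because both
     cliques have at least [#|V|] vertices. *)
  have [|z _|f [injf fD fA]] := @extend_injection _ _ (a |: (b |: C)) h'
     (fun z => if z \in A1 then A else B).
  - have neq_xy : x != y by apply: contraNneq yA => <-.
    have xC z : z \in C -> h' z != x.
      by move=> /h'CAB[_ zB]; apply: contraNneq xB => <-.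
    have yC z : z \in C -> h' z != y.
      by move=> /h'CAB[zB _]; apply: contraNneq yA => <-.
    move=> s t /setU1P[->|/setU1P[->|sC]] /setU1P[->|/setU1P[->|tC]] //;
      rewrite ?h'a ?h'b => /eqP; rewrite ?(negPf neq_xy) ?(eq_sym y x)
        ?(negPf neq_xy) ?(negPf (xC _ _)) ?(negPf (yC _ _)) //.
    + by rewrite eq_sym (negPf (xC _ _)).
    + by rewrite eq_sym (negPf (yC _ _)).
    by rewrite !h'C // => /eqP; apply: injh.
  - by case: ifP.
  have fC z : z \in C -> f z \in A /\ f z \in B.
    by move=> zC; rewrite fD ?inE ?zC ?orbT //; apply: h'CAB.
  have fa : f a = x by rewrite fD ?h'a // setU11.
  have fb : f b = y by rewrite fD ?h'b // !inE eqxx orbT.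
  have fA1 z : z \in A1 -> f z \in A.
    move=> zA1; have [|/fA] := boolP (z \in a |: (b |: C)); last by rewrite zA1.
    case/setU1P=> [->|/setU1P[zb|/fC[]//]]; first by rewrite fa.
    by rewrite -zb zA1 in bA1.
  have fB z : z \notin A1 -> f z \in B.
    move=> zA1; have [|/fA] := boolP (z \in a |: (b |: C)); last by rewrite (negPf zA1).
    case/setU1P=> [za|/setU1P[->|/fC[]//]]; last by rewrite fb.
    by rewrite za aA1 in zA1.
  have fE (p q : V) : f @: [set p; q] = [set f p; f q].
    by rewrite imsetU1 imset_set1.
  rewrite -fa -fb -fE; apply: (Kclosed f) => //; first exact: imset_f.
  apply: copy_missing_edge => d dF ne.
  have [p [q [pq dE]]] := graph_edgeP Fg dF.
  (* Such an edge has an endpoint in [C], whose image lies in both cliques, so the clique holding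
     the image of the other endpoint contains the whole image. *)
  have cross r s : d = [set r; s] -> r \in A1 -> s \notin A1 -> f @: d \in K.
    move=> {}dE rA sA; have rs : r != s by apply: contraNneq sA => <-.
    move: (cut r s); rewrite -dE (negPf ne) /= => /(_ dF rA sA).
    case/orP=> /fC[zA zB]; rewrite dE fE.
      by apply: KB; rewrite ?(inj_eq injf) //; apply: fB.
    by apply: KA; rewrite ?(inj_eq injf) //; apply: fA1.
  have [pA|pA] := boolP (p \in A1); have [qA|qA] := boolP (q \in A1).
  - by rewrite dE fE; apply: KA; rewrite ?fA1 ?(inj_eq injf).
  - exact: cross dE pA qA.
  - by apply: cross qA pA; rewrite setUC.
  - by rewrite dE fE; apply: KB; rewrite ?fB ?(inj_eq injf).
move=> x y /setUP[xA|xB] /setUP[yA|yB] neq_xy.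
- exact: KA.
- have [yA|yA] := boolP (y \in A); first exact: KA.
  have [xB|xB] := boolP (x \in B); first exact: KB.
  by apply: KAB; rewrite in_setD ?xA ?yB ?xB ?yA.
- have [xA|xA] := boolP (x \in A); first exact: KA.
  have [yB|yB] := boolP (y \in B); first exact: KB.
  by rewrite setUC; apply: KAB; rewrite in_setD ?xA ?yB ?xB ?yA.
- exact: KB.
Qed.

Lemma connected_incident (V : finType) (F : {set {set V}}) z :
  is_graph F -> connected_graph F -> 1 < #|V| ->
  exists2 e, e \in F & z \in e.
Proof.
move=> Fg Fc V2.
have [y] : exists y, y \in [set~ z].
  by apply/card_gt0P; rewrite cardsC1; lia.
rewrite !inE => yz; have /forallP/(_ z)/forallP/(_ y)/connectP[[|w p]] := Fc.
  by move=> _ /= yE; rewrite yE eqxx in yz.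
by move=> /andP[zw _] _; exists [set z; w]; rewrite ?set21.
Qed.

(** It shows that the predecessor in [edge_cost] is a genuine subtraction of one, and it supplies
    the edge that percolation adds for free. *)
Lemma touching_edge (V : finType) (F : {set {set V}}) (S : {set V}) :
  is_graph F -> connected_graph F -> 1 < #|V| -> 0 < #|S| ->
  exists e, e \in F :\: induced F (~: S).
Proof.
move=> Fg Fc V2 /card_gt0P[z zS].
have [e eF ze] := connected_incident z Fg Fc V2.
exists e; rewrite !inE eF andbT /=; apply/subsetPn; exists z => //.
by rewrite inE negbK.
Qed.

(** Percolation from [G] makes [A] a clique. Phrased with closed sets, this needs no explicit
    process and is stable under adding edges to [G]. *)
Definition forces (V T : finType) (F : {set {set V}}) (G : {set {set T}})
    (A : {set T}) :=
  forall K, bootstrap_closed F K -> G \subset K -> clique K A.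

(** * The upper bound *)

Section Upper.
Variables (V : finType) (F : {set {set V}}).
Hypotheses (F_graph : is_graph F) (F_connected : connected_graph F).
Hypotheses (V_ge3 : 2 < #|V|) (F_not_4ec : ~~ edge_connected 4 F).
Hypothesis F_wsat : wsat #|V| F = #|F| - 1.

Lemma card_edges_gt0 : 0 < #|F|.
Proof.
have /card_gt0P[z _] : 0 < #|V| by lia.
by apply/card_gt0P; have [|e] := connected_incident z F_graph F_connected; [lia | exists e].
Qed.

Lemma is_graphU (T : finType) (G H : {set {set T}}) :
  is_graph (G :|: H) = is_graph G && is_graph H.
Proof. by rewrite !graph_sub_complete subUset. Qed.

Lemma is_graph_sub_copy (T : finType) (f : {ffun V -> T}) (H : {set {set T}}) :
  injective f -> H \subset copy F f -> is_graph H.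
Proof.
move=> injf Hf; rewrite graph_sub_complete; apply: subset_trans Hf _.
by apply/subsetP => e ef; rewrite inE (card_copy_edge F_graph injf ef).
Qed.

(** The graph is a copy of [F] without one edge: closedness restores the edge, and [copy_clique]
    does the rest. *)
Lemma forces_base (T : finType) :
  #|V| <= #|T| ->
  exists (G : {set {set T}}) (A : {set T}),
    [/\ is_graph G, #|G| <= #|F| - 1, #|A| = #|V| & forces F G A].
Proof.
move=> leVT; have F0 := card_edges_gt0; have /card_gt0P[t0 _] : 0 < #|T| by lia.
have [||f [injf _ _]] := @extend_injection V T set0 (fun=> t0) (fun=> setT).
- by move=> x y; rewrite inE.
- by rewrite cardsT.
have /card_gt0P[e eF] := card_edges_gt0.
exists (copy F f :\ f @: e), (f @: V); split.
- exact: is_graph_sub_copy (subsetDl _ _).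
- by have := cardsD1 (f @: e) (copy F f); rewrite imset_f // copy_card // => ->; rewrite addKn.
- by rewrite card_imset.
move=> K Kclosed GK; apply: (copy_clique F_graph F_wsat) => //.
have eK : f @: e \in K by apply: (Kclosed f) => //; apply: imset_f.
apply/subsetP => d df.
have [->//|de] := eqVneq d (f @: e).
by apply: (subsetP GK); rewrite !inE de.
Qed.

(** An optimal [S] goes to new vertices [N] and the rest of [F] into [A]. The edges avoiding [S] are
    then in the clique already. Of the [edge_cost F i + 1] edges meeting [S], all but [e0] are
    added, and closedness gives [e0]. *)
Lemma forces_extend (T : finType) (G : {set {set T}}) (A : {set T}) i :
  is_graph G -> forces F G A -> #|V| <= #|A| -> #|A| + i <= #|T| ->
  0 < i < #|V|.-1 ->
  exists (G' : {set {set T}}) (A' : {set T}),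
    [/\ is_graph G', #|G'| <= #|G| + edge_cost F i, #|A'| = #|A| + i &
        forces F G' A'].
Proof.
have F0 := card_edges_gt0; move=> Gg GA leVA leAT /andP[i0 iV].
have [|N NA Ni] := @exists_subset _ (~: A) i; first by have := cardsC A; lia.
have [|S Si ->] := @edge_cost_attained _ F i; first by lia.
have [||e0 eX] := touching_edge (S := S) F_graph F_connected; [lia | lia |].
set X := _ :\: _ in eX *.
have /card_gt0P[t0 _] : 0 < #|T| by lia.
have [|h [injh hN]] := @exists_injection _ _ S N t0; first by rewrite Si Ni.
have [//||f [injf fh fA]] := @extend_injection V T S h (fun=> A).
  by move=> z _.
have fN z : z \in S -> f z \in N by move=> zS; rewrite fh // hN.
have fSN : f @: S = N.
  apply/eqP; rewrite eqEcard card_imset // Si Ni leqnn andbT.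
  by apply/subsetP => _ /imsetP[z zS ->]; apply: fN.
exists (G :|: [set f @: e | e : {set V} in X :\ e0]), (A :|: N); split.
- rewrite is_graphU Gg; apply: (is_graph_sub_copy injf).
  by apply: imsetS; apply/subsetP => e /setD1P[_ /setDP[]].
- apply: leq_trans (leq_card_setU _ _) _; rewrite leq_add2l.
  apply: leq_trans (leq_imset_card _ _) _.
  by rewrite [in leqRHS](cardsD1 e0) eX.
- by rewrite cardsU Ni disjoint_setI0 ?cards0 ?subn0 // disjoint_sym disjoints_subset.
move=> K Kclosed; rewrite subUset => /andP[GK XK].
have KA := GA K Kclosed GK.
have fK e : e \in F -> e != e0 -> f @: e \in K.
  move=> eF ne; have [eX'|] := boolP (e \in X).
    by apply: (subsetP XK); apply: imset_f; rewrite in_setD1 ne.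
  rewrite !inE eF andbT negbK /= => eS; apply: (clique_edge KA).
    by apply: (card_copy_edge F_graph injf); apply: imset_f.
  apply/subsetP => _ /imsetP[z ze ->]; apply: fA.
  by have := subsetP eS z ze; rewrite inE.
have e0F : e0 \in F by case/setDP: eX.
have e0K : f @: e0 \in K.
  by apply: (Kclosed f) => //; [apply: imset_f | apply: copy_missing_edge].
have KV : clique K (f @: V).
  apply: (copy_clique F_graph F_wsat) => //.
  apply/subsetP => _ /imsetP[e eF ->].
  by have [->|/fK->] := eqVneq e e0.
have -> : A :|: N = A :|: f @: V.
  apply/setP => x; rewrite !inE; have [//|xA /=] := boolP (x \in A).
  apply/idP/imsetP => [|[z _ xz]].
    by rewrite -fSN => /imsetP[z _ ->]; exists z.
  rewrite xz in xA *; apply: fN; apply: contraNT xA; exact: fA.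
apply: (clique_union F_graph F_connected) => //; first by rewrite card_imset.
(* The image of the complement of [S] lies in both cliques. It has [#|V| - i >= 2] vertices, which
   is why parts are at most [#|V| - 2]. *)
apply: leq_trans (subset_leq_card (A := f @: ~: S) _).
  by rewrite card_imset //; have := cardsC S; lia.
rewrite subsetI; apply/andP; split; last by apply: imsetS; apply/subsetP.
by apply/subsetP => _ /imsetP[z + ->]; rewrite inE => /fA.
Qed.

Lemma forces_parts (T : finType) t :
  parts V t -> #|V| + sumn t <= #|T| ->
  exists (G : {set {set T}}) (A : {set T}),
    [/\ is_graph G, #|G| <= #|F| - 1 + \sum_(j <- t) edge_cost F j,
        #|A| = #|V| + sumn t & forces F G A].
Proof.
elim: t => [_ leVT|i t IHt /= /andP[iV Vt] leT].
  have [|G [A [Gg GF AV GA]]] := @forces_base T; first by rewrite addn0 in leVT.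
  by exists G, A; rewrite big_nil !addn0.
have [|G [A [Gg GF AV GA]]] := IHt Vt.
  by apply: leq_trans leT; rewrite leq_add2l leq_addl.
have leVA : #|V| <= #|A| by rewrite AV leq_addr.
have leAT : #|A| + i <= #|T| by rewrite AV -addnA [sumn t + i]addnC.
have [G' [A' [G'g G'F A'V G'A']]] := forces_extend Gg GA leVA leAT iV.
exists G', A'; split=> //; last by rewrite A'V AV -addnA [sumn t + i]addnC.
by rewrite big_cons (leq_trans G'F) // [edge_cost F i + _]addnC addnA leq_add2r.
Qed.

Lemma wsat_upper n : #|V| <= n -> wsat n F <= g2star F (n - #|V|) + #|F| - 1.
Proof.
move=> leVn; have [t [Vt tn ->]] := g2star_attained F (n - #|V|) V_ge3.
have [|G [A [Gg GF AV GA]]] := forces_parts (T := 'I_n) Vt.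
  by rewrite card_ord tn; lia.
have AT : A = setT.
  by apply/eqP; rewrite eqEcard subsetT cardsT card_ord AV tn; lia.
have F0 := card_edges_gt0; suff /wsat_le : weakly_saturated F G by lia.
apply/(weakly_saturatedP F_graph); split=> // K Kclosed GK.
apply/subsetP => e; rewrite inE => /eqP e2; apply: (clique_edge (GA K Kclosed GK)) => //.
by rewrite AT subsetT.
Qed.

End Upper.

(** * The lower bound *)

Section Lower.
Variables (V T : finType) (F : {set {set V}}) (H : {set {set T}}).
Hypotheses (F_graph : is_graph F) (F_connected : connected_graph F).
Hypotheses (V_ge3 : 2 < #|V|) (V_le_T : #|V| <= #|T|).

Implicit Types (L : seq {set T}) (U e : {set T}).

Definition in_cluster L e := has (fun U => e \subset U) L.
(** This is the value claimed for the weak saturation number on [#|U|] vertices. *)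
Definition cluster_cost U := g2star F (#|U| - #|V|) + (#|F| - 1).
Definition clustering L :=
  all (fun U : {set T} => #|V| <= #|U|) L /\
  \sum_(U <- L) cluster_cost U <= #|[set e in H | in_cluster L e]|.

Lemma in_cluster_sub L e e' : e \subset e' -> in_cluster L e' -> in_cluster L e.
Proof. by move=> ee'; apply: sub_has => U; apply: subset_trans. Qed.

(** Two common vertices is the threshold at which a cluster can contain an edge of a copy of [F] on
    [W]; the clusters left alone contain none. *)
Definition merged L (W : {set T}) :=
  W :|: \bigcup_(U <- L | 1 < #|U :&: W|) U.

Definition merge L (W : {set T}) :=
  merged L W :: [seq U <- L | ~~ (1 < #|U :&: W|)].

Lemma in_cluster_merge L (W : {set T}) e : in_cluster L e -> in_cluster (merge L W) e.
Proof.
case/hasP=> U UL eU; rewrite /in_cluster /=.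
have [UW|UW] := boolP (1 < #|U :&: W|); last first.
  by apply/orP; right; apply/hasP; exists U; rewrite // mem_filter UW.
apply/orP; left; apply: subset_trans eU _; apply: subset_trans (subsetUr _ _).
by rewrite (big_rem U) //= UW subsetUl.
Qed.

(** Each absorbed [U] brings at most [#|U| - #|U :&: W|] new vertices. This number is split at
    [#|V|] so that [g2star] of the first summand is part of the cost of [U] and the second is a
    single admissible part. *)
Lemma card_merged L (W : {set T}) :
  #|W| = #|V| -> all (fun U : {set T} => #|V| <= #|U|) L ->
  #|merged L W| <= #|V| +
    \sum_(U <- L | 1 < #|U :&: W|) ((#|U| - #|V|) + (#|V| - #|U :&: W|)).
Proof.
move=> WV; elim: L => [|U L IHL] /=.
  by rewrite /merged !big_nil setU0 WV addn0.
case/andP=> VU /IHL {}IHL; rewrite /merged !big_cons; case: ifP => // _.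
rewrite setUCA [U :|: _]setUC cardsU [in leqRHS]addnCA addnC.
have : #|U :&: W| <= #|merged L W :&: U|.
  by rewrite subset_leq_card // [merged _ _ :&: _]setIC setIS // subsetUl.
have : #|U :&: W| <= #|V| by rewrite -WV subset_leq_card // subsetIr.
move: IHL; rewrite -/(merged L W); move: (\sum_(_ <- L | _) _) => s.
by move: VU #|merged L W| #|_ :&: W| #|_ :&: U| #|U| #|V| => + m i j u v; lia.
Qed.

(** Subadditivity, together with the fact that [#|V| - #|U :&: W|] lies between 1 and [#|V| - 2], so
    that it is an admissible part. *)
Lemma g2star_merged L (W : {set T}) :
  (forall U, U \in L -> 1 < #|U :&: W| -> #|U :&: W| < #|V|) ->
  g2star F (\sum_(U <- L | 1 < #|U :&: W|) ((#|U| - #|V|) + (#|V| - #|U :&: W|)))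
  <= \sum_(U <- L | 1 < #|U :&: W|)
       (g2star F (#|U| - #|V|) + edge_cost F (#|V| - #|U :&: W|)).
Proof.
elim: L => [|U L IHL] ltL; first by rewrite !big_nil.
rewrite !big_cons; case: ifP => UW; last first.
  by apply: IHL => U' U'L; apply: ltL; rewrite inE U'L orbT.
apply: leq_trans (g2star_add F V_ge3 _ _) _; apply: leq_add; last first.
  by apply: IHL => U' U'L; apply: ltL; rewrite inE U'L orbT.
apply: leq_trans (g2star_add F V_ge3 _ _) _; rewrite leq_add2l.
by have := ltL U (mem_head _ _) UW; move=> ?; apply: g2star_edge_cost; lia.
Qed.

(** The vertices sent outside [U] form a nonempty set [S]. Edges of the copy inside [U] are those
    avoiding [S], and at least [edge_cost F #|S| + 1] edges meet [S]. *)
Lemma edge_cost_cluster (f : {ffun V -> T}) U :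
  injective f -> ~~ (f @: V \subset U) ->
  edge_cost F (#|V| - #|U :&: f @: V|) + #|[set e in copy F f | e \subset U]|
    <= #|F| - 1.
Proof.
move=> injf fU; pose S := ~: (f @^-1: U).
have fSC : f @: (~: S) = U :&: f @: V.
  rewrite setCK; apply/setP => x; rewrite !inE; apply/imsetP/andP.
    by move=> [z + ->]; rewrite inE => fz; split=> //; apply: imset_f.
  by move=> [xU /imsetP[z _ xz]]; exists z; rewrite ?inE -?xz.
have -> : #|V| - #|U :&: f @: V| = #|S|.
  by rewrite -fSC card_imset //; have := cardsC S; lia.
have S0 : 0 < #|S|.
  have /subsetPn[_ /imsetP[z _ ->] fz] := fU.
  by apply/card_gt0P; exists z; rewrite !inE.
have [|e eX] := touching_edge F_graph F_connected _ S0; first by lia.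
have -> : [set e in copy F f | e \subset U] = [set f @: d | d : {set V} in induced F (~: S)].
  apply/setP => c; rewrite inE; apply/andP/imsetP.
    move=> [/imsetP[d dF ->] dU]; exists d => //; rewrite inE dF setCK.
    by apply/subsetP => z zd; rewrite inE (subsetP dU) // imset_f.
  case=> d; rewrite inE setCK => /andP[dF dU] ->; split; first exact: imset_f.
  by apply/subsetP => _ /imsetP[z zd ->]; have := subsetP dU z zd; rewrite inE.
rewrite card_imset; last exact: imset_inj.
have := edge_cost_le F S.
have : 0 < #|F :\: induced F (~: S)| by apply/card_gt0P; exists e.
have := cardsID (induced F (~: S)) F.
have -> : F :&: induced F (~: S) = induced F (~: S).
  by apply/setIidPr/subsetP => d; rewrite inE => /andP[].
by move: (edge_cost F _) #|F :\: _| #|induced F _| #|F| => a b c m; lia.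
Qed.

(** The edges of the copy other than [e] lie in absorbed clusters or are initial edges not counted
    so far. Together they pay for the growth of [g2star] and for the constant [#|F| - 1] of the new
    cluster. *)
Lemma clustering_merge L (f : {ffun V -> T}) e :
  clustering L -> injective f -> e \in copy F f ->
  (forall d, d \in copy F f -> d != e -> d \in H \/ in_cluster L d) ->
  ~~ in_cluster L (f @: V) -> clustering (merge L (f @: V)).
Proof.
set W := f @: V; case=> VL costL injf ef cov nW.
have WV : #|W| = #|V| by rewrite card_imset.
have nWU U : U \in L -> ~~ (W \subset U).
  by move=> UL; apply: contra nW => WU; apply/hasP; exists U.
split.
  rewrite /= -WV subset_leq_card ?subsetUl //=; apply/allP => U.
  by rewrite mem_filter WV => /andP[_ /(allP VL)].
pose M := [set d in copy F f | ~~ in_cluster L d] :\ e.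
have F_le : #|F| <= #|M|.+1 +
    \sum_(U <- L | 1 < #|U :&: W|) #|[set d in copy F f | d \subset U]|.
  have : #|copy F f| <= #|e |: M| + #|\bigcup_(U <- L | 1 < #|U :&: W|)
      [set d in copy F f | d \subset U]|.
    apply: leq_trans (leq_card_setU _ _); apply: subset_leq_card.
    apply/subsetP => d df; rewrite !inE df /=.
    have [//|ne /=] := eqVneq d e; have [dL|//] := boolP (in_cluster L d).
    case/hasP: dL => U UL dU.
    have UW : 1 < #|U :&: W|.
      rewrite -(card_copy_edge F_graph injf df) subset_leq_card // subsetI dU.
      by case/imsetP: df => d' _ ->; apply: imsetS; apply/subsetP.
    by rewrite (big_rem U) //= UW !inE df dU.
  rewrite copy_card // => /leq_trans; apply; apply: leq_add.
    by rewrite cardsU1; case: (_ \notin _).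
  elim/big_rec2: _ => [|U m B _ Bm]; first by rewrite cards0.
  by apply: leq_trans (leq_card_setU _ _) _; rewrite leq_add2l.
(* The edge [e] accounts for the [- 1] in the cost. For each absorbed [U], the charge [edge_cost]
   plus the edges of the copy inside [U] is at most [#|F| - 1], which completes
   [g2star F (#|U| - #|V|)] to the cost of [U]. *)
have cost_merged : cluster_cost (merged L W) <=
    \sum_(U <- L | 1 < #|U :&: W|) cluster_cost U + #|M|.
  have g_le : g2star F (#|merged L W| - #|V|) <= \sum_(U <- L | 1 < #|U :&: W|)
       (g2star F (#|U| - #|V|) + edge_cost F (#|V| - #|U :&: W|)).
    apply: leq_trans (g2star_merged _).
      by apply: g2star_mono => //; rewrite leq_subLR card_merged.
    move=> U /nWU WU _; rewrite ltnNge -WV; apply: contra WU => le_WU.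
    have /eqP <- : U :&: W == W by rewrite eqEcard subsetIr.
    exact: subsetIl.
  apply: leq_trans (leq_add g_le (leq_sub2r 1 F_le)) _.
  rewrite subn1 /= addnCA -big_split /= addnC leq_add2r.
  rewrite big_seq_cond [in leqRHS]big_seq_cond; apply: leq_sum => U /andP[UL _].
  by rewrite -addnA leq_add2l edge_cost_cluster // nWU.
rewrite big_cons big_filter.
apply: leq_trans (leq_add cost_merged (leqnn _)) _.
rewrite (bigID (fun U : {set T} => 1 < #|U :&: W|)) /= in costL.
rewrite addnAC; apply: leq_trans (leq_add costL (leqnn _)) _.
set A := [set d in H | in_cluster L d].
(* Edges of [M] avoid all old clusters and lie in [H], so merging makes them newly counted, on top
   of [A]. *)
have AM0 : A :&: M = set0.
  by apply/setP => d; rewrite !inE; case: in_cluster; rewrite ?andbF.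
have := cardsUI A M; rewrite AM0 cards0 addn0 => <-.
apply/subset_leq_card/subsetP => d; rewrite !inE => /orP[/andP[-> dL]|].
  exact: in_cluster_merge.
case/and3P=> de df dL; have [->|/(negP dL)//] := cov d df de.
rewrite /= /in_cluster /=; apply/orP; left; apply: subset_trans (subsetUl _ _).
by case/imsetP: df => d' _ ->; apply: imsetS; apply/subsetP.
Qed.

(** As long as [H] together with all subsets of clusters is not closed, merging along a violating
    copy covers a new edge and keeps the invariant. Once closed, this family contains all edges by
    weak saturation. *)
Lemma clustering_closed L :
  weakly_saturated F H -> clustering L ->
  exists2 L', clustering L' & complete_graph T \subset H :|: [set e | in_cluster L' e].
Proof.
case/(weakly_saturatedP F_graph) => Hg HT.
have [k] := ubnP #|~: (H :|: [set e | in_cluster L e])|.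
elim: k L => // k IHk L leK cL.
have [/HT TK|[f [e [injf ef fK eK]]]] :=
  not_bootstrap_closed F (H :|: [set e | in_cluster L e]).
  by exists L; rewrite // TK // subsetUl.
have eW : e \subset f @: V.
  by case/imsetP: ef => d' _ ->; apply: imsetS; apply/subsetP.
have cL' : clustering (merge L (f @: V)).
  apply: (clustering_merge cL injf ef).
    move=> d df de; apply/orP; have := subsetP fK d.
    by rewrite !inE de df; apply.
  by move: eK; rewrite !inE; apply: contra => /(in_cluster_sub eW)->; rewrite orbT.
apply: (IHk _ _ cL'); rewrite ltnS in leK; apply: leq_trans leK.
apply: proper_card; rewrite properC; apply/properP; split.
  by apply: setUS; apply/subsetP => d; rewrite !inE; apply: in_cluster_merge.
exists e => //; rewrite !inE /in_cluster /=; apply/orP; right; apply/orP; left.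
exact: subset_trans eW (subsetUl _ _).
Qed.

(** With overlap at least [#|V| - 1], the union exceeds [#|V|] by at most one more than the two
    excesses combined. The extra [g2star F 1 <= edge_cost F 1 <= #|F| - 1] is paid by the constant
    saved when two clusters become one. *)
Lemma clustering_pair L U1 U2 :
  clustering L -> U1 \in L -> U2 \in L -> U1 != U2 -> #|V|.-1 <= #|U1 :&: U2| ->
  exists2 L', clustering L' &
    U1 :|: U2 \in L' /\ forall e, in_cluster L e -> in_cluster L' e.
Proof.
move=> [VL costL] U1L U2L neq12 leV12.
have U2L' : U2 \in rem U1 L by rewrite rem_mem // eq_sym.
pose R := rem U2 (rem U1 L).
have permL : perm_eq L [:: U1, U2 & R].
  by rewrite (perm_trans (perm_to_rem U1L)) // perm_cons perm_to_rem.
move: VL costL; rewrite (perm_all _ permL) (perm_big _ permL) /= !big_cons.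
move=> /and3P[VU1 VU2 VR] costL.
have RL e : in_cluster L e -> in_cluster (U1 :|: U2 :: R) e.
  rewrite /in_cluster (perm_has _ permL) /= orbA.
  case/orP=> [/orP[] eU|->]; rewrite ?orbT // (subset_trans eU) //.
    exact: subsetUl.
  exact: subsetUr.
exists (U1 :|: U2 :: R); last by split=> //; rewrite mem_head.
split; first by rewrite /= VR andbT (leq_trans VU1) // subset_leq_card ?subsetUl.
rewrite big_cons; apply: leq_trans (_ : _ <= #|[set e in H | in_cluster L e]|) _.
  apply: leq_trans costL; rewrite addnA leq_add2r.
  have le12 : #|U1 :|: U2| - #|V| <= 1 + ((#|U1| - #|V|) + (#|U2| - #|V|)).
    rewrite cardsU; move: VU1 VU2 leV12 V_ge3.
    by move: #|_ :&: _| #|U1| #|U2| #|V| => i u1 u2 v; lia.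
  have g_le := leq_trans (g2star_mono F V_ge3 le12) (g2star_add F V_ge3 _ _).
  have g12 := g2star_add F V_ge3 (#|U1| - #|V|) (#|U2| - #|V|).
  have g1 : g2star F 1 <= #|F| - 1.
    rewrite subn1; apply: leq_trans (edge_cost_leF F 1).
    by apply: g2star_edge_cost => //; lia.
  rewrite /cluster_cost; move: g_le g12 g1.
  move: (g2star F _) (g2star F _) (g2star F _) (g2star F _) (g2star F _) => *; lia.
by apply/subset_leq_card/subsetP => e; rewrite !inE => /andP[-> /RL].
Qed.

(** If [x] is outside [U], take a copy on [x] and [#|V| - 1] vertices of [U]. Either its vertex set
    lies in another cluster, which overlaps [U] enough for [clustering_pair], or [clustering_merge]
    applies. Both give a larger cluster containing [U] and [x]. *)
Lemma clustering_top L U :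
  complete_graph T \subset H :|: [set e | in_cluster L e] -> clustering L ->
  U \in L -> cluster_cost [set: T] <= #|H|.
Proof.
have [k] := ubnP #|~: U|; elim: k L U => // k IHk L U leUk TL cL UL.
have [VL costL] := cL; have VU := allP VL U UL.
have [U0|[x]] := set_0Vmem (~: U).
  have <- : U = setT by rewrite -[U]setCK U0 setC0.
  apply: leq_trans (_ : _ <= #|[set e in H | in_cluster L e]|) _; last first.
    by apply: subset_leq_card; apply/subsetP => e; rewrite inE => /andP[].
  by apply: leq_trans costL; rewrite (big_rem U) //= leq_addr.
rewrite inE => xU; have /card_gt0P[z _] : 0 < #|V| by lia.
have [|//|f [injf fz fU]] :=
    @extend_injection V T [set z] (fun=> x) (fun=> U).
  by move=> y1 y2 /set1P-> /set1P->.
have {}fz : f z = x by rewrite fz ?set11.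
pose W := f @: V.
have xW : x \in W by rewrite -fz imset_f.
have UW : #|V|.-1 <= #|U :&: W|.
  rewrite -(cardsC1 z) -(card_imset (mem [set~ z]) injf) subset_leq_card //.
  rewrite subsetI; apply/andP; split; last by apply: imsetS; apply/subsetP.
  by apply/subsetP => _ /imsetP[y + ->]; rewrite !inE => yz; rewrite fU // inE.
have grow L' U' : clustering L' -> (forall e, in_cluster L e -> in_cluster L' e) ->
    U' \in L' -> U \subset U' -> x \in U' -> cluster_cost [set: T] <= #|H|.
  move=> cL' LL' U'L' UU' xU'; apply: (IHk L' U') => //.
    rewrite ltnS in leUk; apply: leq_trans leUk; apply: proper_card.
    by rewrite properC; apply/properP; split=> //; exists x.
  by apply: subset_trans TL _; apply: setUS; apply/subsetP => e; rewrite !inE => /LL'.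
have [/hasP[U2 U2L WU2]|nW] := boolP (in_cluster L W).
  have xU2 := subsetP WU2 x xW.
  have neqU : U != U2 by apply: contraNneq xU => ->.
  have le2 : #|V|.-1 <= #|U :&: U2|.
    by apply: leq_trans UW _; apply: subset_leq_card; apply: setIS.
  have [L' cL' [UL' LL']] := clustering_pair cL UL U2L neqU le2.
  by apply: (grow L' _ cL' LL' UL'); rewrite ?subsetUl // inE xU2 orbT.
have /card_gt0P[e0 e0F] : 0 < #|F|.
  apply/card_gt0P; have [|e eF _] := connected_incident z F_graph F_connected.
    by lia.
  by exists e.
have ef : f @: e0 \in copy F f by apply: imset_f.
(* Every edge is already initial or in a cluster, so any edge of the copy may play the part of the
   completed one. *)
apply: (grow (merge L W) (merged L W)).
- apply: (clustering_merge cL injf ef) => // d df _; apply/orP.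
  have := subsetP TL d; rewrite !inE (card_copy_edge F_graph injf df).
  exact.
- by move=> e; apply: in_cluster_merge.
- exact: mem_head.
- apply: subset_trans (subsetUr _ _); rewrite (big_rem U) //=.
  by rewrite ifT ?subsetUl //; lia.
- by rewrite inE xW.
Qed.

Lemma weakly_saturated_card :
  weakly_saturated F H -> g2star F (#|T| - #|V|) + #|F| - 1 <= #|H|.
Proof.
move=> Hws; have cnil : clustering [::] by split=> //; rewrite big_nil.
have [L cL TL] := clustering_closed Hws cnil.
have /card_gt0P[z _] : 0 < #|V| by lia.
have [|e0 e0F _] := connected_incident z F_graph F_connected; first by lia.
have F0 : 0 < #|F| by apply/card_gt0P; exists e0.
(* The clustering may still be empty, for instance when [H] is complete. Merging along an arbitrary
   copy then creates a first cluster. *)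
suff [L' [U [cL' TL' UL']]] : exists L' U,
    [/\ clustering L', complete_graph T \subset H :|: [set e | in_cluster L' e]
      & U \in L'].
  have := clustering_top TL' cL' UL'.
  by rewrite /cluster_cost cardsT addnBA.
have /card_gt0P[t0 _] : 0 < #|T| by lia.
have [||f [injf _ _]] := @extend_injection V T set0 (fun=> t0) (fun=> setT).
- by move=> x y; rewrite inE.
- by rewrite cardsT.
have [/hasP[U UL _]|nW] := boolP (in_cluster L (f @: V)); first by exists L, U.
have ef : f @: e0 \in copy F f by apply: imset_f.
exists (merge L (f @: V)), (merged L (f @: V)); split; last exact: mem_head.
- apply: (clustering_merge cL injf ef) => // d df _; apply/orP.
  have := subsetP TL d; rewrite !inE (card_copy_edge F_graph injf df).
  exact.
apply: subset_trans TL _; apply: setUS; apply/subsetP => e; rewrite !inE.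
exact: in_cluster_merge.
Qed.

End Lower.

Theorem mainTheorem10 (V : finType) (F : {set {set V}})
    (F_graph : is_graph F) (F_connected : connected_graph F)
    (V_ge3 : 3 <= #|V|) (F_not_4ec : ~~ edge_connected 4 F)
    (F_wsat : wsat #|V| F = #|F| - 1)
    (n : nat) (n_ge : #|V| <= n) :
  wsat n F = g2star F (n - #|V|) + #|F| - 1.
Proof.
apply/eqP; rewrite eqn_leq wsat_upper //=.
have [G Gws ->] := wsat_attained F n.
have := weakly_saturated_card F_graph F_connected V_ge3 _ Gws.
by rewrite card_ord; apply.
Qed.
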